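(* For each integer $d\ge 5$, the integer $d-1$ is a typical rank for real bivariate homogeneous polynomials of degree $d$. That is, there is a non-empty subset $V\subseteq \mathbb{R}[x,y]_d$, open for the euclidean topology of the real vector space $\mathbb{R}[x,y]_d$, such that $Rsr(f)=d-1$ for all $f\in V$.
   Context: For an integer $d\ge 0$, $\mathbb{R}[x,y]_d$ denotes the $(d+1)$-dimensional real vector space of all homogeneous polynomials of degree $d$ in the two variables $x,y$ with real coefficients. For $f\in\mathbb{R}[x,y]_d$, the real rank $Rsr(f)$ is the minimal integer $r$ such that $f=\sum_{i=1}^{r}c_iL_i^d$ for some $c_i\in\mathbb{R}$ and some linear forms $L_i\in\mathbb{R}[x,y]_1$. An integer $t>0$ is called a typical rank in degree $d$ (for real bivariate degree $d$ forms) if there is a non-empty subset $V$ of $\mathbb{R}[x,y]_d$, open for the euclidean topology, such that $Rsr(f)=t$ for all $f\in V$. *)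

(* Defs.v *)
From mathcomp Require Import all_boot all_order all_algebra.
From mathcomp Require Import all_classical all_reals all_analysis.
(* The notations of mpoly clash with those of MathComp-Analysis; without them,
   [mpoly n R] is {mpoly R[n]} and [dhomog n R d] is its subspace of homogeneous
   polynomials of degree d (0 included), a finite-dimensional R-vector space. *)
From mathcomp Require Import -(notations) mpoly.

Set Implicit Arguments.
Unset Strict Implicit.
Unset Printing Implicit Defensive.

Import Order.TTheory GRing.Theory Num.Theory.
Import numFieldNormedType.Exports.

Local Open Scope classical_set_scope.
Local Open Scope ring_scope.

Definition binary_form (R : realType) (d : nat) : vectType R := dhomog 2 R d.

(* The library puts no topology on an abstract [vectType]; [r2v] is its linear
   isomorphism from row vectors to vT.  As linear automorphisms of R^n are
   homeomorphisms, the topology does not depend on the isomorphism chosen. *)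
Definition euclidean_open (R : realType) (vT : vectType R) (V : set vT) : Prop :=
  open ((@VectorInternalTheory.r2v R vT) @^-1` V).

Definition sum_of_powers (R : realType) (d : nat) (f : binary_form R d)
    (r : nat) : Prop :=
  exists (c : 'I_r -> R) (L : 'I_r -> dhomog 2 R 1),
    (f : mpoly 2 R) = \sum_(i < r) c i *: (L i : mpoly 2 R) ^+ d.

(* [Rsr f r] is the graph of the rank function: it reads Rsr(f) = r. *)
Definition Rsr (R : realType) (d : nat) (f : binary_form R d) (r : nat) : Prop :=
  sum_of_powers f r /\ forall s : nat, sum_of_powers f s -> (r <= s)%N.

Definition typical_rank (R : realType) (d t : nat) : Prop :=
  (0 < t)%N /\
  exists V : set (binary_form R d),
    [/\ V !=set0, euclidean_open V & forall f, V f -> Rsr f t].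

(* Main.v *)
Require Import Defs.
From mathcomp Require Import all_boot all_order all_algebra.
From mathcomp Require Import ring lra zify.
From mathcomp Require Import all_classical all_reals all_analysis.
From mathcomp Require Import -(notations) mpoly.

(** Write a form of degree [d] as [f = \sum_j 'C(d, j) a_j x^j y^(d - j)] and
    let its coefficients act on univariate polynomials by the functional
    [l P = \sum_j a_j P_j], so that the power [(x0 x + y0 y)^d] becomes the
    homogeneous evaluation at [(x0, y0)].  Rank is then read off apolarity:

    - if [f] is a sum of [r] powers, then [l] vanishes on all multiples, of
      degree at most [d], of a product [G] of at most [r] real linear factors
      ([annihilator_of_powers]);
    - if [l g = l (X g) = 0] for a monic [g] of degree [d - 1] with [d - 1]
      distinct real roots [t_i], then [f] is a combination of the powers
      [(t_i x + y)^d] ([powers_of_annihilator], a Vandermonde argument).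

    The open set is a neighbourhood of one explicit form.  Take
    [g = (X - 1) ... (X - (d - 1))] and
    [l0 P = Re (conj (g(i)) P(i)) - (|g(i)|^2 / g(0)) P(0)].
    The first term is a harmonic form, the second a multiple of [y^d], and both
    are adjusted so that [l0 g = l0 (X g) = 0].

    Upper bound.  For [l] near [l0], the two equations [l g = l (X g) = 0] are
    restored by a small correction [g + s X + t X^2]: the linear system in
    [(s, t)] has determinant near [- |g(i)|^2 <> 0].  The corrected polynomial
    still changes sign between consecutive half-integers, hence has [d - 1] distinct real
    roots ([near_center_sum_of_powers]).

    Lower bound.  If [l] came from at most [d - 2] powers, it would vanish on
    [X G] and [X^2 G].  On multiples of [X] the functional [l0] only sees its
    harmonic part, and [l0 (X G)^2 + l0 (X^2 G)^2 = |g(i)|^2 |G(i)|^2].  Since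
    [G] has only real roots, its coefficients are bounded by a constant times
    [|G(i)|] ([coef_linprod_le]), so a small perturbation [l - l0] cannot cancel
    these values ([near_center_rank_ge]).  In terms of forms: all the iterated
    directional derivatives of a harmonic form are harmonic and nonzero, and
    by compactness this survives perturbation. *)

Set Implicit Arguments.
Unset Strict Implicit.
Unset Printing Implicit Defensive.

Import Order.TTheory GRing.Theory Num.Theory.
Import numFieldNormedType.Exports.

Local Open Scope classical_set_scope.
Local Open Scope ring_scope.

(** * Apolarity between coefficient sequences and polynomials *)

Section Pairing.
Variable R : comNzRingType.
Implicit Types (a b : nat -> R) (P Q : {poly R}).

Definition pairing (d : nat) a P : R := \sum_(j < d.+1) a j * P`_j.

Definition shift a : nat -> R := fun j => a j.+1.

Lemma eq_pairing d a b P :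
  (forall j, (j <= d)%N -> a j = b j) -> pairing d a P = pairing d b P.
Proof. by move=> ab; apply: eq_bigr => j _; rewrite ab // -ltnS. Qed.

Lemma pairingD d a P Q : pairing d a (P + Q) = pairing d a P + pairing d a Q.
Proof. by rewrite -big_split; apply: eq_bigr => j _; rewrite coefD mulrDr. Qed.

Lemma pairingZ d a x P : pairing d a (x *: P) = x * pairing d a P.
Proof. by rewrite mulr_sumr; apply: eq_bigr => j _; rewrite coefZ mulrCA. Qed.

Lemma pairing_linl d a b x y P :
  pairing d (fun j => x * a j + y * b j) P = x * pairing d a P + y * pairing d b P.
Proof.
by rewrite !mulr_sumr -big_split; apply: eq_bigr => j _; rewrite mulrDl !mulrA.
Qed.

Lemma pairing_suml d r (c : 'I_r -> R) (a : 'I_r -> nat -> R) P :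
  pairing d (fun j => \sum_(i < r) c i * a i j) P =
  \sum_(i < r) c i * pairing d (a i) P.
Proof.
under [RHS]eq_bigr do rewrite mulr_sumr.
rewrite exchange_big; apply: eq_bigr => j _.
by rewrite mulr_suml; apply: eq_bigr => i _; rewrite mulrA.
Qed.

Lemma pairing_Xn d a k : (k <= d)%N -> pairing d a 'X^k = a k.
Proof.
move=> kd; rewrite /pairing (bigD1 (Ordinal (n:=d.+1) kd)) //= coefXn eqxx mulr1.
rewrite big1 ?addr0 // => j /negPf jk; rewrite coefXn.
by move: jk; rewrite -val_eqE /= => ->; rewrite mulr0.
Qed.

Lemma pairing_X d a : (0 < d)%N -> pairing d a 'X = a 1%N.
Proof. by move=> d0; rewrite -['X]expr1 pairing_Xn. Qed.

(** Multiplying the polynomial by [X] amounts, up to a scalar, to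
    differentiating the form along [x], which shifts its coefficients. *)
Lemma pairing_mulX d a P :
  (size P <= d)%N -> pairing d a ('X * P) = pairing d (shift a) P.
Proof.
move=> sP; rewrite /pairing big_ord_recl coefXM mulr0 add0r.
rewrite [RHS]big_ord_recr /= (nth_default _ sP) mulr0 addr0.
by apply: eq_bigr => j _; rewrite coefXM.
Qed.

Lemma pairing_linear_factor d a x y P : (size P <= d)%N ->
  pairing d a ((y *: 'X - x%:P) * P) = y * pairing d (shift a) P - x * pairing d a P.
Proof.
move=> sP; rewrite mulrBl -scalerAl mul_polyC -scaleNr pairingD !pairingZ.
by rewrite pairing_mulX // mulNr.
Qed.

(** The functional of [(x x' + y y')^d] is the homogeneous evaluation at
    [(x, y)], hence is killed by the linear form vanishing there. *)
Lemma pairing_root d x y P : (size P <= d)%N ->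
  pairing d (fun j => x ^+ j * y ^+ (d - j)) ((y *: 'X - x%:P) * P) = 0.
Proof.
move=> sP; rewrite pairing_linear_factor // -mulNr -pairing_linl.
rewrite /pairing big_ord_recr /= (nth_default _ sP) mulr0 addr0.
rewrite big1 // => j _; rewrite /shift.
have -> : (d - j = (d - j.+1).+1)%N by rewrite subnSK.
by rewrite !exprS; ring.
Qed.

(** The dehomogenized product of the linear forms vanishing at the points of
    [s]; the point [(1, 0)] at infinity contributes a constant factor. *)
Definition linprod (s : seq (R * R)) : {poly R} :=
  \prod_(p <- s) (p.2 *: 'X - p.1%:P).

Lemma size_linear_factor x y : (size (y *: 'X - x%:P : {poly R})%R <= 2)%N.
Proof.
rewrite (leq_trans (size_polyD _ _)) // geq_max size_polyN.
rewrite (leq_trans (size_scale_leq _ _)) ?size_polyX //=.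
by rewrite (leq_trans (size_polyC_leq1 _)).
Qed.

Lemma size_linprod s : (size (linprod s) <= (size s).+1)%N.
Proof.
elim: s => [|p s IH]; first by rewrite /linprod big_nil size_poly1.
rewrite /linprod big_cons (leq_trans (size_polyMleq _ _)) // -subn1 leq_subLR.
exact: leq_add (size_linear_factor _ _) IH.
Qed.

(** Degenerate linear forms [(0, 0)] contribute nothing to [a], so they are
    discarded before the product is formed: this keeps the product nonzero. *)
Lemma annihilator_of_powers d r (c : 'I_r -> R) (x y : 'I_r -> R) (a : nat -> R) :
    (0 < d)%N ->
    (forall j, (j <= d)%N -> a j = \sum_(i < r) c i * (x i ^+ j * y i ^+ (d - j))) ->
  exists s : seq (R * R), [/\ (size s <= r)%N, {in s, forall p, p != (0, 0)} &
    forall Q, (size Q + r <= d.+1)%N -> pairing d a (Q * linprod s) = 0].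
Proof.
move=> d0 aE.
pose s := [seq p <- [seq (x i, y i) | i <- enum 'I_r] | p != (0, 0)].
have sr : (size s <= r)%N.
  by rewrite (leq_trans (size_subseq (filter_subseq _ _))) // size_map size_enum_ord.
exists s; split => // [p|Q sQ]; first by rewrite mem_filter => /andP[].
rewrite (eq_pairing _ aE) pairing_suml big1 // => i _.
have [xy0|xyN0] := eqVneq (x i, y i) (0, 0).
  case: xy0 => -> ->; rewrite /pairing big1 ?mulr0 // => j _.
  rewrite -exprD subnKC; last by rewrite -ltnS.
  by rewrite expr0n gtn_eqF ?mul0r.
have si : (x i, y i) \in s.
  by rewrite mem_filter xyN0 map_f // mem_enum.
rewrite /linprod (perm_big _ (perm_to_rem si)) big_cons /= -/(linprod _) mulrCA.
rewrite pairing_root ?mulr0 //.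
have s0 : (0 < size s)%N by case: (s) si.
rewrite (leq_trans (size_polyMleq _ _)) // -subn1 leq_subLR add1n.
rewrite (leq_trans (leq_add (leqnn _) (size_linprod _))) //.
by rewrite (size_rem si) prednK // (leq_trans _ sQ) // leq_add2l.
Qed.

End Pairing.

(** * Evaluation at the imaginary unit *)

Section EvalAtI.
Variable R : realFieldType.

(** The real part of the [j]-th power of [i]. *)
Definition re_powi (j : nat) : R := if odd j then 0 else (-1) ^+ j./2.

Lemma re_powiSS j : re_powi j.+2 = - re_powi j.
Proof. by rewrite /re_powi /= negbK; case: odd; rewrite ?oppr0 // exprS mulN1r. Qed.

Definition re_at_i d P := pairing d re_powi P.
(** [Re (i P(i))], which is minus the imaginary part of [P(i)]. *)
Definition neg_im_at_i d P := pairing d (shift re_powi) P.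
(** The squared modulus of [P(i)], if [P] has degree at most [d]. *)
Definition sqnorm_at_i d P := re_at_i d P ^+ 2 + neg_im_at_i d P ^+ 2.

(** Multiplicativity of the modulus: [|y i - x|^2 = x^2 + y^2]. *)
Lemma sqnorm_linear_factor d x y (P : {poly R}) : (size P <= d)%N ->
  sqnorm_at_i d ((y *: 'X - x%:P) * P) = (x ^+ 2 + y ^+ 2) * sqnorm_at_i d P.
Proof.
move=> sP; rewrite /sqnorm_at_i /re_at_i /neg_im_at_i !pairing_linear_factor //.
have -> : pairing d (shift (shift re_powi)) P = - pairing d re_powi P.
  rewrite /pairing -sumrN; apply: eq_bigr => j _.
  by rewrite /shift re_powiSS mulNr.
by ring.
Qed.

Lemma sqnorm_at_i1 d : sqnorm_at_i d 1 = 1.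
Proof.
rewrite /sqnorm_at_i /re_at_i /neg_im_at_i -(expr0 'X) !pairing_Xn // /shift /re_powi /=.
by rewrite expr0; ring.
Qed.

Lemma sqnorm_linprod_gt0 d (s : seq (R * R)) : (size s <= d)%N ->
  {in s, forall p, p != (0, 0)} -> 0 < sqnorm_at_i d (linprod s).
Proof.
elim: s => [|[x y] s IH] /= sd sN0.
  by rewrite /linprod big_nil sqnorm_at_i1.
rewrite /linprod big_cons sqnorm_linear_factor; last first.
  exact: leq_trans (size_linprod _) sd.
rewrite mulr_gt0 ?IH //; [|exact: ltnW|by move=> p ps; apply: sN0; rewrite inE ps orbT].
have := sN0 (x, y) (mem_head _ _); rewrite xpair_eqE negb_and => /orP[] h.
  by rewrite ltr_pwDl ?sqr_ge0 // exprn_even_gt0.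
by rewrite ltr_wpDl ?sqr_ge0 // exprn_even_gt0.
Qed.

(** A product of real linear forms cannot be small at [i] without having small
    coefficients: each factor multiplies [|P(i)|] by exactly [|(x, y)|] and the
    largest coefficient by at most [|x| + |y|].  The constant does not depend on
    the position of the roots, which replaces a compactness argument. *)
Lemma coef_linprod_le d (s : seq (R * R)) (j : nat) : (size s <= d)%N ->
  (linprod s)`_j ^+ 2 <= 2 ^+ size s * sqnorm_at_i d (linprod s).
Proof.
elim: s j => [|[x y] s IH] j sd.
  by rewrite /linprod big_nil sqnorm_at_i1 coef1 expr0 mulr1; case: j => [|j] /=; lra.
rewrite /linprod big_cons sqnorm_linear_factor -/(linprod s); last first.
  exact: leq_trans (size_linprod _) sd.
rewrite mulrBl -scalerAl mul_polyC coefB !coefZ coefXM /= (exprS _ (size s)).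
set M := 2 ^+ size s * _ in IH *.
have sd' : (size s <= d)%N by apply: ltnW.
have M0 : 0 <= M by rewrite (le_trans _ (IH 0%N sd')) // sqr_ge0.
have -> : 2 * 2 ^+ size s * ((x ^+ 2 + y ^+ 2) * sqnorm_at_i d (linprod s)) =
  2 * (x ^+ 2 + y ^+ 2) * M by rewrite /M; ring.
set u := if _ then _ else _; set v := _`_j.
have uM : u ^+ 2 <= M by rewrite /u; case: eqP => _; rewrite ?expr0n ?IH.
have vM : v ^+ 2 <= M by apply: IH.
(* Cauchy-Schwarz *)
apply: (@le_trans _ _ ((x ^+ 2 + y ^+ 2) * (u ^+ 2 + v ^+ 2))).
  by rewrite -subr_ge0 (_ : _ - _ = (y * v + x * u) ^+ 2) ?sqr_ge0 //; ring.
rewrite (mulrC 2) -mulrA ler_wpM2l ?addr_ge0 ?sqr_ge0 //; lra.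
Qed.

End EvalAtI.

(** * The central form *)

Section Center.
Variables (R : realFieldType) (d : nat) (g : {poly R}).

(** The coefficients of the functional
    [P |-> Re (conj (g(i)) P(i)) - (|g(i)|^2 / g(0)) P(0)]: the factor
    [conj (g(i))] makes [X g], and the constant term makes [g], apolar to it. *)
Definition center : nat -> R := fun j =>
  re_at_i d g * re_powi R j + neg_im_at_i d g * re_powi R j.+1 -
  (j == 0)%N%:R * (sqnorm_at_i d g / g.[0]).

Lemma shift_center j :
  shift center j = re_at_i d g * re_powi R j.+1 - neg_im_at_i d g * re_powi R j.
Proof. by rewrite /shift /center re_powiSS mul0r subr0 mulrN. Qed.

Lemma pairing_shift_center P :
  pairing d (shift center) P =
  re_at_i d g * neg_im_at_i d P - neg_im_at_i d g * re_at_i d P.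
Proof.
rewrite -mulNr -pairing_linl; apply: eq_pairing => j _.
by rewrite shift_center mulNr.
Qed.

Lemma pairing_shift2_center P :
  pairing d (shift (shift center)) P =
  - (re_at_i d g * re_at_i d P + neg_im_at_i d g * neg_im_at_i d P).
Proof.
rewrite opprD -!mulNr -pairing_linl; apply: eq_pairing => j _.
by rewrite [LHS]shift_center re_powiSS !mulNr mulrN.
Qed.

Lemma pairing_center : g.[0] != 0 -> pairing d center g = 0.
Proof.
move=> g0.
have -> : pairing d center g =
    pairing d (fun j => re_at_i d g * re_powi R j + neg_im_at_i d g * shift (re_powi R) j) g -
    sqnorm_at_i d g / g.[0] * g`_0.
  rewrite /pairing 2!big_ord_recl /= /center /shift /=.
  under eq_bigr do rewrite mul0r subr0.
  by ring.
rewrite pairing_linl -horner_coef0 mulfVK // /sqnorm_at_i.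
by rewrite -/(re_at_i d g) -/(neg_im_at_i d g) !expr2 subrr.
Qed.

Lemma pairing_shift_center_self : pairing d (shift center) g = 0.
Proof. by rewrite pairing_shift_center mulrC subrr. Qed.

(** On the multiples of [X] only the harmonic part of [center] remains, and
    the values at [X P] and [X^2 P] are the two coordinates of the complex
    number [conj (g(i)) P(i)], up to order and sign. *)
Lemma sqnorm_center P :
  pairing d (shift center) P ^+ 2 + pairing d (shift (shift center)) P ^+ 2 =
  sqnorm_at_i d g * sqnorm_at_i d P.
Proof.
rewrite pairing_shift_center pairing_shift2_center /sqnorm_at_i; ring.
Qed.

End Center.

(** * From an apolar polynomial to a sum of powers *)

(** The two annihilation conditions say that [a] satisfies the linear
    recurrence with characteristic polynomial [g]; as the roots are distinct,
    the solutions are the combinations of the geometric sequences [t_i ^+ j]. *)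
Lemma powers_of_annihilator (R : fieldType) (n : nat) (a : nat -> R) (g : {poly R})
    (t : 'I_n -> R) :
    g \is monic -> size g = n.+1 -> injective t -> (forall i, root g (t i)) ->
    pairing n.+1 a g = 0 -> pairing n.+1 (shift a) g = 0 ->
  exists c : 'I_n -> R,
    forall j, (j <= n.+1)%N -> a j = \sum_(i < n) c i * t i ^+ j.
Proof.
move=> gm sg tinj gt ag asg.
pose T := Vandermonde n (\row_i t i).
have Tu : T \in unitmx.
  rewrite unitmxE det_Vandermonde unitfE; apply/prodf_neq0 => i _.
  apply/prodf_neq0 => j ij; rewrite !mxE subr_eq0 inj_eq //.
  by apply: contraTN ij => /eqP ->; rewrite ltnn.
pose c := invmx T *m \col_(j < n) a j.
exists (fun i => c i 0).
pose b j := \sum_(i < n) c i 0 * t i ^+ j.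
have ab j : (j < n)%N -> a j = b j.
  move=> jn; have : (T *m c) (Ordinal jn) 0 = a j by rewrite mulKVmx // mxE.
  by move=> <-; rewrite !mxE; apply: eq_bigr => i _; rewrite !mxE mulrC.
have eval x : pairing n.+1 (fun j => x ^+ j) g = g.[x].
  rewrite (horner_coef_wide (n := n.+2)) ?sg //.
  by apply: eq_bigr => j _; rewrite mulrC.
have bg : pairing n.+1 b g = 0.
  by rewrite pairing_suml big1 // => i _; rewrite eval (rootP (gt i)) mulr0.
have bsg : pairing n.+1 (shift b) g = 0.
  rewrite (@eq_pairing _ _ _ (fun j => \sum_(i < n) (c i 0 * t i) * t i ^+ j)).
    by rewrite pairing_suml big1 // => i _; rewrite eval (rootP (gt i)) mulr0.
  by move=> j _; apply: eq_bigr => i _; rewrite exprS mulrA.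
(* a sequence satisfying the recurrence is determined by its first n terms,
   because g is monic *)
have top (u v : nat -> R) : (forall j, (j < n)%N -> u j = v j) ->
    pairing n.+1 u g = pairing n.+1 v g -> u n = v n.
  move=> uv; rewrite /pairing !big_ord_recr /= (nth_default _ (_ : size g <= n.+1)%N) ?sg //.
  have -> : g`_n = 1 by move/monicP: gm; rewrite /lead_coef sg.
  rewrite !mulr0 !addr0 !mulr1.
  rewrite (eq_bigr (fun j : 'I_n => v j * g`_j)); first by apply: addrI.
  by move=> j _; rewrite uv.
have an : a n = b n by apply: top => //; rewrite ag bg.
have ab1 j : (j <= n)%N -> a j = b j.
  by rewrite leq_eqVlt => /predU1P[-> //|/ab].
have an1 : shift a n = shift b n.
  by apply: top => [j jn|]; [apply: ab1|rewrite asg bsg].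
by move=> j; rewrite leq_eqVlt => /predU1P[-> //|/ab1].
Qed.

Lemma roots_of_sign_changes (R : rcfType) (n : nat) (g : {poly R}) (x : nat -> R) :
    {homo x : i j / (i <= j)%N >-> i <= j} ->
    (forall k, (k < n)%N -> g.[x k] * g.[x k.+1] < 0) ->
  exists t : 'I_n -> R, injective t /\ forall i, root g (t i).
Proof.
move=> xmono gx.
have H (k : 'I_n) : {y | x k < y < x k.+1 & root g y}.
  apply: cid2; have gxk := gx k (ltn_ord k).
  have xk : x k <= x k.+1 by apply: xmono.
  clear gx; wlog gk : g gxk / g.[x k] <= 0.
    move=> W; have [/W|gk] := leP g.[x k] 0; first exact.
    have [||y yx] := W (- g); rewrite ?hornerN ?mulrNN ?oppr_le0 1?ltW //.
    by rewrite rootN; exists y.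
  have gk1 : 0 <= g.[x k.+1].
    by rewrite leNgt; apply: contraTN gxk => g1; rewrite -leNgt mulr_le0 // ltW.
  have [|y /andP[ky yk] ry] := @poly_ivt R g _ _ xk; first exact/andP.
  have gN0 : (g.[x k] != 0) && (g.[x k.+1] != 0).
    by rewrite -negb_or -mulf_eq0 lt_eqF.
  exists y => //; move: gN0 => /andP[gk0 gk10].
  rewrite !lt_neqAle ky yk !andbT; apply/andP; split.
    by apply: contraNneq gk0 => ->.
  by apply: contraNneq gk10 => <-.
exists (fun k => s2val (H k)); split => [i j|i]; last exact: s2valP' (H i).
have lt_t (i' j' : 'I_n) : (i' < j')%N -> s2val (H i') < s2val (H j').
  move=> ij; have /andP[_ h1] := s2valP (H i'); have /andP[h2 _] := s2valP (H j').
  by apply: (lt_trans h1); apply: (le_lt_trans _ h2); apply: xmono.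
move=> tij; apply/val_inj; case: (ltngtP i j) => // /lt_t; rewrite tij ltxx //.
Qed.

Section NodePoly.
Variables (R : realFieldType) (n : nat).

Definition node_poly : {poly R} := \prod_(k < n) ('X - (k.+1%:R)%:P).

Lemma node_poly_monic : node_poly \is monic.
Proof. exact: monic_prod_XsubC. Qed.

Lemma size_node_poly : size node_poly = n.+1.
Proof. by rewrite /node_poly -big_enum size_prod_XsubC size_enum_ord. Qed.

Lemma node_poly0 : node_poly.[0] != 0.
Proof.
rewrite horner_prod; apply/prodf_neq0 => k _.
by rewrite hornerXsubC sub0r oppr_eq0 pnatr_eq0.
Qed.

Lemma sqnorm_node_poly_gt0 d : (n <= d)%N -> 0 < sqnorm_at_i d node_poly.
Proof.
move=> nd; have -> : node_poly = linprod [seq (k.+1%:R, 1) | k : 'I_n <- enum 'I_n].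
  rewrite /linprod big_map big_enum /=; apply: eq_bigr => k _.
  by rewrite scale1r.
apply: sqnorm_linprod_gt0; first by rewrite size_map size_enum_ord.
by move=> p /mapP[k _ ->]; rewrite xpair_eqE oner_eq0 andbF.
Qed.

Definition half_point (k : nat) : R := k%:R + 2^-1.

Lemma node_poly_sign k : (k < n)%N ->
  node_poly.[half_point k] * node_poly.[half_point k.+1] < 0.
Proof.
move=> kn; rewrite !horner_prod -big_split (bigD1 (Ordinal kn)) //=.
rewrite pmulr_llt0.
  by rewrite !hornerXsubC /half_point (natrD _ 1 k); lra.
apply: prodr_gt0 => j jk; rewrite !hornerXsubC /half_point.
have : (j < k)%N || (k < j)%N.
  by move: jk; rewrite -val_eqE /= neq_ltn.
have S1 (m : nat) : m.+1%:R = m%:R + 1 :> R by rewrite natr1.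
rewrite -!(ler_nat R) (S1 j) (S1 k) => /orP[] h; first by apply: mulr_gt0; lra.
by rewrite nmulr_rgt0; lra.
Qed.

End NodePoly.

(** * Perturbation of the central form *)

Lemma sqr_pairing_le (R : rcfType) d (a b : nat -> R) (P : {poly R}) (K : R) :
    (forall j, P`_j ^+ 2 <= K) -> pairing d a P = 0 ->
  pairing d b P ^+ 2 <= (\sum_(j < d.+1) `|a j - b j|) ^+ 2 * K.
Proof.
move=> PK aP.
have K0 : 0 <= K by rewrite (le_trans _ (PK 0%N)) // sqr_ge0.
have PsK j : `|P`_j| <= Num.sqrt K by rewrite -sqrtr_sqr ler_sqrt.
have : `|pairing d b P| <= (\sum_(j < d.+1) `|a j - b j|) * Num.sqrt K.
  have -> : pairing d b P = - (pairing d a P - pairing d b P) by rewrite aP sub0r opprK.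
  rewrite normrN -sumrB (le_trans (ler_norm_sum _ _ _)) // mulr_suml.
  by apply: ler_sum => j _; rewrite -mulrBl normrM ler_wpM2l.
rewrite -{2}(sqr_sqrtr K0) -exprMn -(real_normK (num_real (pairing d b P))).
by move=> le_norm; rewrite ler_pXn2r // nnegrE (le_trans _ le_norm).
Qed.

Section Near.
Context (R : realType) (T : Type) (F : set_system T) (FF : Filter F).

Lemma cvg_pairing d (a : T -> nat -> R) (a0 : nat -> R) P :
    (forall j, (j <= d)%N -> a w j @[w --> F] --> a0 j) ->
  pairing d (a w) P @[w --> F] --> pairing d a0 P.
Proof.
move=> aF; apply: cvg_big => [|j _]; first exact: add_continuous.
by apply: cvgM; [apply: aF; rewrite -ltnS|apply: cvg_cst].
Qed.

(** The correction is sought in the span of [X] and [X^2] because there the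
    pairings only involve [a_1], [a_2], [a_3], which belong to the harmonic
    part: the determinant at the center is [- |g(i)|^2].  As both have degree
    less than [g], the corrected polynomial remains monic. *)
Lemma near_center_sum_of_powers n (a : T -> nat -> R) : (2 < n)%N ->
    (forall j, (j <= n.+1)%N ->
      a w j @[w --> F] --> center n.+1 (node_poly R n) j) ->
  \near F, exists c t : 'I_n -> R,
    forall j, (j <= n.+1)%N -> a F j = \sum_(i < n) c i * t i ^+ j.
Proof.
move=> n2 aF; set g := node_poly R n; pose d := n.+1.
(* Cramer's formulas for l(g + s X + t X^2) = l(X (g + s X + t X^2)) = 0 *)
pose D w := a w 1%N * a w 3%N - a w 2%N ^+ 2.
pose u w := pairing d (a w) g; pose v w := pairing d (shift (a w)) g.
pose s w := (v w * a w 2%N - u w * a w 3%N) / D w.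
pose t w := (u w * a w 2%N - v w * a w 1%N) / D w.
pose gw w := g + s w *: 'X + t w *: 'X^2.
have sg : size g = n.+1 by exact: size_node_poly.
have gm : g \is monic by exact: node_poly_monic.
have d3 : (3 <= d)%N by rewrite /d; lia.
have c1 := aF 1%N isT; have c2 := aF 2 (ltnW d3); have c3 := aF 3 d3.
have cD : D w @[w --> F] --> - sqnorm_at_i d g.
  have -> : - sqnorm_at_i d g = center d g 1 * center d g 3 - center d g 2 ^+ 2.
    rewrite -![center d g _.+1]/(shift (center d g) _) !shift_center.
    by rewrite /re_powi /= expr0 expr1 /sqnorm_at_i; ring.
  by apply: cvgB; [apply: cvgM|rewrite expr2; apply: cvgM].
have N0 : - sqnorm_at_i d g != 0.
  by rewrite oppr_eq0 gt_eqF // sqnorm_node_poly_gt0.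
have cu : u w @[w --> F] --> 0.
  by rewrite -(pairing_center d (node_poly0 R n)); apply: cvg_pairing.
have cv : v w @[w --> F] --> 0.
  rewrite -(pairing_shift_center_self d g) /v.
  rewrite (_ : (fun w => _) = fun w => pairing d (a w) ('X * g)); last first.
    by apply/funext => w; rewrite pairing_mulX // sg.
  by rewrite -pairing_mulX ?sg //; apply: cvg_pairing.
have cvg_quot (p q h k : T -> R) (hl kl : R) :
    p w @[w --> F] --> 0 -> q w @[w --> F] --> 0 ->
    h w @[w --> F] --> hl -> k w @[w --> F] --> kl ->
    (p w * h w - q w * k w) / D w @[w --> F] --> 0.
  move=> cp cq ch ck.
  suff : (p w * h w - q w * k w) / D w @[w --> F] -->
      (0 * hl - 0 * kl) / - sqnorm_at_i d g by rewrite !mul0r subr0 mul0r.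
  by apply: cvgM; [apply: cvgB; apply: cvgM|apply: cvgV].
have cs : s w @[w --> F] --> 0 by apply: cvg_quot cv cu c2 c3.
have ct : t w @[w --> F] --> 0 by apply: cvg_quot cu cv c2 c1.
have cg x : (gw w).[x] @[w --> F] --> g.[x].
  rewrite (_ : (fun w => _) = fun w => g.[x] + s w * x + t w * x ^+ 2); last first.
    by apply/funext => w; rewrite !hornerE.
  suff : g.[x] + s w * x + t w * x ^+ 2 @[w --> F] --> g.[x] + 0 * x + 0 * x ^+ 2.
    by rewrite !mul0r !addr0.
  by do ![apply: cvgD|apply: cvgM|exact: cvg_cst|by []].
have near_sign : \near F, forall k : 'I_n,
    (gw F).[half_point R k] * (gw F).[half_point R k.+1] < 0.
  apply: filter_forall => k; apply: cvgr_lt (node_poly_sign R (ltn_ord k)).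
  by apply: cvgM.
have near_D : \near F, D F < 0.
  apply: cvgr_lt cD _ _.
  by rewrite lt_neqAle N0 oppr_le0 addr_ge0 ?sqr_ge0.
apply: filterS2 near_sign near_D => w sw Dw.
have Dw0 : a w 1%N * a w 3%N - a w 2%N ^+ 2 != 0 by rewrite lt_eqF.
have [|tt [ttinj rt]] := @roots_of_sign_changes R n (gw w) (half_point R) _
  (fun k kn => sw (Ordinal kn)).
  by move=> i j ij; rewrite lerD2r ler_nat.
have small : (size (s w *: 'X + t w *: 'X^2 : {poly R})%R < size g)%N.
  rewrite sg ltnS (leq_trans (size_polyD _ _)) // geq_max.
  by rewrite !(leq_trans (size_scale_leq _ _)) ?size_polyX ?size_polyXn // ltnW.
have swg : size (gw w) = n.+1 by rewrite /gw -addrA size_polyDl.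
have mgw : gw w \is monic.
  by rewrite monicE /gw -addrA lead_coefDl //; rewrite -monicE.
have [||c cE] := powers_of_annihilator mgw swg ttinj rt (a := a w).
- rewrite /gw !pairingD !pairingZ pairing_X // pairing_Xn ?(ltnW d3) //.
  by rewrite -/(u w) /s /t /D; field.
- rewrite /gw !pairingD !pairingZ pairing_X // pairing_Xn ?(ltnW d3) //.
  by rewrite -/(v w) /s /t /D /shift; field.
by exists c, tt.
Qed.

(** Exact vanishing on [X G] and [X^2 G] would force the center to be as small
    there as the perturbation times the coefficients of [G], against
    [sqnorm_center] and [coef_linprod_le]. *)
Lemma near_center_rank_ge d g (a : T -> nat -> R) : (0 < d)%N ->
    0 < sqnorm_at_i d g ->
    (forall j, (j <= d)%N -> a w j @[w --> F] --> center d g j) ->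
  \near F, forall r (c x y : 'I_r -> R),
    (forall j, (j <= d)%N -> a F j = \sum_(i < r) c i * (x i ^+ j * y i ^+ (d - j))) ->
    (d <= r.+1)%N.
Proof.
move=> d0 Ng aF; pose N := @sqnorm_at_i R d.
pose eta w := \sum_(j < d.+1) `|a w j - center d g j|.
have ceta : eta w ^+ 2 * 2 ^+ d.+1 @[w --> F] --> 0.
  rewrite -[0](mul0r (2 ^+ d.+1)).
  apply: cvgM; last exact: cvg_cst.
  rewrite (_ : 0 = (\sum_(j < d.+1) `|center d g j - center d g j|) ^+ 2); last first.
    by rewrite big1 ?expr0n // => j _; rewrite subrr normr0.
  have cs : eta w @[w --> F] --> \sum_(j < d.+1) `|center d g j - center d g j|.
    apply: cvg_big => [|j _]; first exact: add_continuous.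
    apply: cvg_norm; apply: cvgB; last exact: cvg_cst.
    by apply: aF; rewrite -ltnS.
  by rewrite !expr2; apply: cvgM.
apply: filterS (cvgr_lt _ ceta _ Ng) => w eta_small r c x y aE.
rewrite leqNgt; apply/negP => rd.
have [s [sr sN0 ann]] := annihilator_of_powers d0 aE.
have sd : (size s <= d)%N by lia.
set G := linprod s in ann.
have NG : 0 < N G by apply: sqnorm_linprod_gt0.
have sG : (size G < d)%N by rewrite (leq_ltn_trans (size_linprod _)) //; lia.
have shiftX b : pairing d (shift b) G = pairing d b ('X^1 * G).
  by rewrite expr1 pairing_mulX // ltnW.
have shiftX2 b : pairing d (shift (shift b)) G = pairing d b ('X^2 * G).
  rewrite -(pairing_mulX (shift b) (ltnW sG)) -pairing_mulX; last first.
    by rewrite (leq_trans (size_polyMleq _ _)) // size_polyX.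
  by rewrite mulrA expr2.
have bound k : (k <= 2)%N ->
    pairing d (center d g) ('X^k * G) ^+ 2 <= eta w ^+ 2 * (2 ^+ d * N G).
  move=> k2; apply: sqr_pairing_le => [j|]; last first.
    by rewrite ann // size_polyXn; lia.
  rewrite coefXnM; case: ifP => _.
    by rewrite expr0n mulr_ge0 ?exprn_ge0 // ltW.
  rewrite (le_trans (coef_linprod_le _ sd)) // ler_wpM2r ?(ltW NG) //.
  by rewrite ler_weXn2l // ler1n.
have := bound 1%N isT; have := bound 2%N isT.
rewrite -shiftX -shiftX2 => b2 b1.
have : N g * N G <= eta w ^+ 2 * 2 ^+ d.+1 * N G.
  rewrite -sqnorm_center (le_trans (lerD b1 b2)) // le_eqVlt; apply/orP; left.
  by apply/eqP; rewrite (exprS _ d); ring.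
by rewrite leNgt ltr_pM2r // eta_small.
Qed.

End Near.

(** * Binary forms and their coefficients *)

Section BinaryForms.
Variable R : realType.

Definition varx : mpoly 2 R := mpolyX R (mnm1 (0 : 'I_2)).
Definition vary : mpoly 2 R := mpolyX R (mnm1 (1 : 'I_2)).

Definition expo (d j : nat) : multinom 2 :=
  mnm_add (mnm_muln (mnm1 (0 : 'I_2)) j) (mnm_muln (mnm1 (1 : 'I_2)) (d - j)).

Lemma expo0 d j : expo d j 0 = j.
Proof. by rewrite /expo mnmDE !mulmnE !mnm1E /= mul1n mul0n addn0. Qed.

Lemma expo1 d j : expo d j 1 = (d - j)%N.
Proof. by rewrite /expo mnmDE !mulmnE !mnm1E /= mul1n mul0n. Qed.

Lemma mdeg_expo d j : (j <= d)%N -> mdeg (expo d j) = d.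
Proof. by move=> jd; rewrite mdegD !mdegMn !mdeg1 !mul1n subnKC. Qed.

Lemma mpolyX_expo d j : mpolyX R (expo d j) = varx ^+ j * vary ^+ (d - j).
Proof. by rewrite mpolyXD !mpolyXn. Qed.

Lemma expo_inj d : injective (expo d).
Proof. by move=> i j /(congr1 (fun m : multinom 2 => m 0)); rewrite !expo0. Qed.

Lemma expoP d (m : multinom 2) : mdeg m = d -> (m 0%R <= d)%N /\ m = expo d (m 0).
Proof.
rewrite mdegE !big_ord_recl big_ord0 addn0 => md.
have E : m (lift ord0 ord0) = m 1 by congr (m _); apply/val_inj.
rewrite E in md; split; first by rewrite -md leq_addr.
apply/mnmP => i; case: (altP (i =P 0)) => [->|i0]; first by rewrite expo0.
have -> : i = 1 by apply/val_inj; case: i i0 => [[|[|]]].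
by rewrite expo1 -md addKn.
Qed.

(** The binomial weights turn the powers of linear forms into geometric
    sequences of coefficients, see [linear_form_pow]. *)
Definition form_of (d : nat) (a : nat -> R) : mpoly 2 R :=
  \sum_(j < d.+1) (a j *+ 'C(d, j)) *: mpolyX R (expo d j).

Definition coefs d (f : mpoly 2 R) (j : nat) : R :=
  mcoeff (expo d j) f / 'C(d, j)%:R.

Lemma binN0 d j : (j <= d)%N -> ('C(d, j)%:R : R) != 0.
Proof. by move=> jd; rewrite pnatr_eq0 -lt0n bin_gt0. Qed.

Lemma eq_form_of d a b : (forall j, (j <= d)%N -> a j = b j) ->
  form_of d a = form_of d b.
Proof. by move=> ab; apply: eq_bigr => j _; rewrite ab // -ltnS. Qed.

Lemma coefs_form_of d a j : (j <= d)%N -> coefs d (form_of d a) j = a j.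
Proof.
move=> jd; rewrite /coefs /form_of raddf_sum (bigD1 (Ordinal (n:=d.+1) jd)) //=.
rewrite big1 ?addr0 => [|k /negPf jk].
  by rewrite mcoeffZ mcoeffX eqxx mulr1 -(mulr_natr (a j)) mulfK // binN0.
rewrite mcoeffZ mcoeffX (inj_eq (@expo_inj d)).
by move: jk; rewrite -val_eqE /= => ->; rewrite mulr0.
Qed.

Lemma form_of_coefs d (f : dhomog 2 R d) : form_of d (coefs d f) = f.
Proof.
apply/mpolyP => m; have [/expoP [md ->]|md] := eqVneq (mdeg m) d.
  have := coefs_form_of (coefs d f) md; rewrite /coefs => /divIf; apply.
  exact: binN0.
rewrite (dhomog_nemf_coeff (dhomog_is_dhomog f) md) /form_of raddf_sum big1 //= => j _.
rewrite mcoeffZ mcoeffX; case: eqP => [E|]; last by rewrite mulr0.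
by move: md; rewrite -E mdeg_expo ?eqxx // -ltnS.
Qed.

Lemma form_of_dhomog d a : form_of d a \is ishomog1 d (@mdeg 2).
Proof.
by apply: rpred_sum => j _; rewrite rpredZ // dhomogX /= mdeg_expo // -ltnS.
Qed.

Lemma linear_form_pow d x y : (x *: varx + y *: vary) ^+ d =
  form_of d (fun j => x ^+ j * y ^+ (d - j)).
Proof.
rewrite addrC exprDn; apply: eq_bigr => j _.
rewrite mpolyX_expo !exprZn -scalerAl -scalerAr scalerA scalerMnl.
by rewrite (mulrC (y ^+ _)) (mulrC (vary ^+ _)).
Qed.

Lemma dhomog1E (L : dhomog 2 R 1) :
  exists x y, (L : mpoly 2 R) = x *: varx + y *: vary.
Proof.
exists (coefs 1 L 1), (coefs 1 L 0); rewrite -{1}(form_of_coefs L) /form_of.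
rewrite !big_ord_recl big_ord0 addr0 !mpolyX_expo /= !bin0 !mulr1n.
by rewrite expr0 !expr1 mul1r mulr1 addrC.
Qed.

Lemma sum_form_of d r (c : 'I_r -> R) (a : 'I_r -> nat -> R) :
  \sum_(i < r) c i *: form_of d (a i) =
  form_of d (fun j => \sum_(i < r) c i * a i j).
Proof.
rewrite /form_of; under eq_bigr do rewrite scaler_sumr.
rewrite exchange_big; apply: eq_bigr => j _.
rewrite -sumrMnl scaler_suml; apply: eq_bigr => i _.
by rewrite scalerA mulrnAr.
Qed.

Lemma sum_of_powersP d (f : binary_form R d) r :
  sum_of_powers f r <-> exists c x y : 'I_r -> R,
    forall j, (j <= d)%N ->
      coefs d f j = \sum_(i < r) c i * (x i ^+ j * y i ^+ (d - j)).
Proof.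
split=> [[c [L fE]]|[c [x [y fE]]]].
  have /choice[xy LE] : forall i, exists p : R * R,
      (L i : mpoly 2 R) = p.1 *: varx + p.2 *: vary.
    by move=> i; have [x [y ->]] := dhomog1E (L i); exists (x, y).
  exists c, (fun i => (xy i).1), (fun i => (xy i).2) => j jd.
  rewrite fE; under eq_bigr do rewrite LE linear_form_pow.
  by rewrite sum_form_of coefs_form_of.
have linh (p : R * R) : p.1 *: varx + p.2 *: vary \is ishomog1 1 (@mdeg 2).
  have := form_of_dhomog 1 (fun j => p.1 ^+ j * p.2 ^+ (1 - j)).
  by rewrite -linear_form_pow.
exists c, (fun i => DHomog (linh (x i, y i))).
rewrite -form_of_coefs (eq_form_of fE) -sum_form_of; apply: eq_bigr => i _.
by rewrite /= linear_form_pow.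
Qed.

End BinaryForms.

(** * The neighbourhood of the central form *)

Import VectorInternalTheory.

Lemma linear_rV_continuous (R : realType) (n : nat) (phi : {scalar 'rV[R]_n}) :
  continuous phi.
Proof.
have -> : (phi : 'rV[R]_n -> R) =
    fun w => \sum_(i < n) w 0 i * phi (delta_mx 0 i).
  apply/funext => w; rewrite {1}[w]row_sum_delta linear_sum.
  by apply: eq_bigr => i _; rewrite linearZ.
apply: continuous_big => [|i _]; first exact: add_continuous.
move=> v; exact: continuousM (@coord_continuous R 1 n 0 i v)
  (@cst_continuous _ _ (phi (delta_mx 0 i)) v).
Qed.

Lemma coefs_r2v_continuous (R : realType) (d j : nat) :
  continuous (fun w : 'rV[R]_(dim (binary_form R d)) =>
    coefs d (r2v w : binary_form R d) j).
Proof.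
pose phi := mcoeff (expo d j) \o @mpoly_of_dhomog 2 R d \o
            @r2v R (binary_form R d).
move=> v; exact: continuousM (@linear_rV_continuous R _ phi v)
  (@cst_continuous _ _ ('C(d, j)%:R^-1 : R) v).
Qed.

Theorem theorem1 (R : realType) (d : nat) (hd : (5 <= d)%N) :
  typical_rank R d (d - 1)%N.
Proof.
have dE : d = (d - 1).+1 by rewrite subn1 prednK //; lia.
set n := (d - 1)%N in dE *; have n2 : (2 < n)%N by rewrite /n; lia.
have n0 : (0 < n)%N by lia.
clearbody n; rewrite {d}dE in hd *.
split; first exact: n0.
pose a0 := center n.+1 (node_poly R n).
pose f0 : binary_form R n.+1 := DHomog (form_of_dhomog n.+1 a0).
(* the open set is the interior of the locus of rank n, so that only a
   neighbourhood of f0 has to be examined *)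
pose S := [set w | Rsr (r2v w : binary_form R n.+1) n].
have nearS : nbhs (v2r f0) S.
  have ca j : (j <= n.+1)%N ->
      coefs n.+1 (r2v w : binary_form R n.+1) j @[w --> v2r f0] --> a0 j.
    move=> jn; have := @coefs_r2v_continuous R n.+1 j (v2r f0).
    by rewrite /continuous_at v2rK /f0 /= coefs_form_of.
  have up := near_center_sum_of_powers (nbhs_filter (v2r f0)) n2 ca.
  have low := near_center_rank_ge (nbhs_filter (v2r f0)) (ltn0Sn n)
    (sqnorm_node_poly_gt0 R (leqnSn n)) ca.
  apply: (@filterS2 _ _ (nbhs_filter (v2r f0))) up low => w [c [t fE]] low; split.
    (* the powers found are those of t_i x + y *)
    apply/sum_of_powersP; exists c, t, (fun=> 1) => j jn.
    by rewrite fE //; apply: eq_bigr => i _; rewrite expr1n mulr1.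
  by move=> r /sum_of_powersP[c' [x [y E]]]; rewrite -ltnS (low r c' x y).
exists (v2r @^-1` S°); split.
- by exists f0; exact: nearS.
- rewrite /euclidean_open (_ : _ @^-1` _ = S°); first exact: open_interior.
  by apply/seteqP; split => w /=; rewrite r2vK.
- by move=> f /interior_subset; rewrite /S /= v2rK.
Qed.
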